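(* The solid factor trie $\mathcal{T}$ of a weighted sequence $X$ of length $n$ (with threshold probability $\frac1z$) can be constructed in $O(nz)$ time.
   Context: Model: word-RAM with word size $\Omega(\log(nz))$; the alphabet $\Sigma$ has constant size; probabilities are represented so that they can be multiplied exactly in $O(1)$ time. A weighted sequence $X=x_1\ldots x_n$ over $\Sigma$ assigns to each position $i$ and letter $s$ a probability $\pi_i(s)\ge0$ with $\sum_s\pi_i(s)=1$. A string $F$ is a solid factor of $X$ at position $i$ (ending at $j=i+|F|-1\le n$; $F$ may be empty) if $\prod_{k=1}^{|F|}\pi_{i+k-1}(F[k])\ge\frac1z$. The heavy string $\mathbf{X}$ is obtained by choosing at each position a letter of maximum probability (ties broken arbitrarily). The extension of a solid factor $F$ starting at $i$ and ending at $j\ge i-1$ is $F\,\mathbf{X}[j+1..n]$; $\mathcal{E}$ is the set of extensions of all solid factors of $X$. A trie is a rooted tree with edges labelled by letters, edges going down from a node having distinct labels; for a node $u$ with ancestor $v$, $\mathrm{str}(u,v)$ is the string of labels read along the path from $u$ up to $v$. The solid factor trie $\mathcal{T}$ of $X$ is the trie with $\{\mathrm{str}(u,\mathrm{root}):u\in\mathcal{T}\}=\mathcal{E}$ (i.e. it represents the reversals of the strings of $\mathcal{E}$). *)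

(* Defs.v *)
From HB Require Import structures.
From mathcomp Require Import all_boot all_order all_algebra.

Set Implicit Arguments.
Unset Strict Implicit.
Unset Printing Implicit Defensive.

Import Order.TTheory GRing.Theory Num.Theory.
Local Open Scope ring_scope.

(* Positions are numbered from 0, so X`_i s is the probability of the letter s
   at the (i+1)-st position, and X[j+1..n] is [drop j X]. *)

Definition weighted_sequence (R : realFieldType) (Sigma : finType)
    (X : seq {ffun Sigma -> R}) : Prop :=
  forall i, (i < size X)%N ->
    (forall s, 0 <= X`_i s) /\ \sum_(s : Sigma) X`_i s = 1.

(* The default value of [nth] is irrelevant, since i < size X = size H. *)
Definition heavy_string (R : realFieldType) (Sigma : finType)
    (X : seq {ffun Sigma -> R}) (H : seq Sigma) : Prop :=
  size H = size X /\
  forall i s, (i < size X)%N -> X`_i s <= X`_i (nth s H i).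

(* F may be empty, and i = size X is then allowed (F starts just after the end
   of X and its extension is the empty string). *)
Definition solid_factor (R : realFieldType) (Sigma : finType)
    (X : seq {ffun Sigma -> R}) (z : R) (i : nat) (F : seq Sigma) : Prop :=
  (i + size F <= size X)%N /\
  z^-1 <= \prod_(k < size F) X`_(i + k) (tnth (in_tuple F) k).

Definition extension (Sigma : finType) (H : seq Sigma) (i : nat)
    (F : seq Sigma) : seq Sigma :=
  F ++ drop (i + size F) H.

Definition solid_extensions (R : realFieldType) (Sigma : finType)
    (X : seq {ffun Sigma -> R}) (z : R) (H : seq Sigma) (S : seq Sigma) : Prop :=
  exists i F, solid_factor X z i F /\ S = extension H i F.

(* [str_up parent v u S] means that v is an ancestor of u and S = str(u,v),
   where [parent u = Some (p, s)] when the edge from p down to u is labelled s. *)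
Inductive str_up (Sigma node : Type) (parent : node -> option (node * Sigma))
    (v : node) : node -> seq Sigma -> Prop :=
| str_up_here : str_up parent v v [::]
| str_up_edge u p s S :
    parent u = Some (p, s) -> str_up parent v p S ->
    str_up parent v u (s :: S).

(* Only the root has no parent and the edges going down from a node have
   distinct labels: together this says that [parent] is injective. *)
Record trie (Sigma : finType) := Trie {
  node : finType;
  root : node;
  parent : node -> option (node * Sigma);
  parent_root : parent root = None;
  parent_inj : injective parent;
  root_ancestor : forall u, exists S, str_up parent root u S
}.

Arguments root {Sigma} t.
Arguments parent {Sigma} t u.

Definition str (Sigma : finType) (T : trie Sigma) (u v : node T)
    (S : seq Sigma) : Prop := str_up (parent T) v u S.

Definition solid_factor_trie (R : realFieldType) (Sigma : finType)
    (X : seq {ffun Sigma -> R}) (z : R) (H : seq Sigma) (T : trie Sigma) : Prop :=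
  forall S, (exists u : node T, str u (root T) S) <-> solid_extensions X z H S.

(* The word-RAM with word size w.  A word is a natural number smaller than
   2 ^ w, and every result is reduced modulo 2 ^ w.  Probabilities live in
   separate registers and in a separate memory bank addressed by words; they
   can only be moved, compared and multiplied (exactly), and every instruction
   takes one unit of time. *)

Inductive word_op :=
  | OpAdd | OpSub | OpMul | OpDiv | OpMod | OpAnd | OpOr | OpXor | OpShl | OpShr.

Definition eval_op (w : nat) (o : word_op) (a b : nat) : nat :=
  (match o with
   | OpAdd => a + b
   | OpSub => a + 2 ^ w - b
   | OpMul => a * b
   | OpDiv => a %/ b
   | OpMod => a %% b
   | OpAnd => Nat.land a b
   | OpOr => Nat.lor a b
   | OpXor => Nat.lxor a b
   | OpShl => a * 2 ^ b
   | OpShr => a %/ 2 ^ b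
   end %% 2 ^ w)%N.

Inductive instr :=
  | WConst (d k : nat)
  | WOp (o : word_op) (d a b : nat)
  | WLoad (d a : nat)
  | WStore (a b : nat)
  | Jump (l : nat)
  | JumpEq (a b l : nat)
  | JumpLt (a b l : nat)
  | POne (d : nat)
  | PMul (d a b : nat)
  | PLoad (d a : nat)
  | PStore (a b : nat)
  | PJumpLe (a b l : nat).

Definition program := seq instr.

Record config (R : Type) := Config {
  pc : nat;
  wreg : nat -> nat;
  wmem : nat -> nat;
  preg : nat -> R;
  pmem : nat -> R
}.

Definition exec (R : realFieldType) (w : nat) (i : instr) (c : config R) :
    config R :=
  let: Config l r m q p := c in
  match i with
  | WConst d k => Config l.+1 [eta r with d |-> (k %% 2 ^ w)%N] m q p
  | WOp o d a b => Config l.+1 [eta r with d |-> eval_op w o (r a) (r b)] m q p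
  | WLoad d a => Config l.+1 [eta r with d |-> m (r a)] m q p
  | WStore a b => Config l.+1 r [eta m with r a |-> r b] q p
  | Jump l' => Config l' r m q p
  | JumpEq a b l' => Config (if r a == r b then l' else l.+1) r m q p
  | JumpLt a b l' => Config (if (r a < r b)%N then l' else l.+1) r m q p
  | POne d => Config l.+1 r m [eta q with d |-> 1] p
  | PMul d a b => Config l.+1 r m [eta q with d |-> q a * q b] p
  | PLoad d a => Config l.+1 r m [eta q with d |-> p (r a)] p
  | PStore a b => Config l.+1 r m q [eta p with r a |-> q b]
  | PJumpLe a b l' => Config (if q a <= q b then l' else l.+1) r m q p
  end.

Definition step (R : realFieldType) (P : program) (w : nat) (c : config R) :
    config R :=
  if onth P (pc c) is Some i then exec w i c else c.

(* The machine stops when the program counter leaves the program. *)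
Definition halted (R : Type) (P : program) (c : config R) : Prop :=
  (size P <= pc c)%N.

Definition run (R : realFieldType) (P : program) (w t : nat) (c : config R) :
    config R :=
  iter t (step P w) c.

(* Input: the length n in word register 0, the threshold 1/z in probability
   register 0, and the n x #|Sigma| table of the probabilities of X, row by row,
   in the probability memory; everything else is 0.  The letter s is encoded by
   the word [enum_rank s]. *)
Definition input (R : realFieldType) (Sigma : finType)
    (X : seq {ffun Sigma -> R}) (z : R) : config R :=
  Config 0
    [eta (fun=> 0%N) with 0%N |-> size X]
    (fun=> 0%N)
    [eta (fun=> 0) with 0%N |-> z^-1]
    (fun a => [seq (x : {ffun Sigma -> R}) s | x <- X, s <- enum Sigma]`_a).

(* Output: a pointer to the root in word register 0; each node u is stored at a
   nonzero address [addr u] as the array of the pointers to its children,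
   indexed by letters, with 0 as the null pointer. *)
Definition stores_trie (R : Type) (Sigma : finType) (w : nat) (c : config R)
    (T : trie Sigma) : Prop :=
  exists addr : node T -> nat,
    [/\ injective addr,
        forall u, (0 < addr u)%N /\ (addr u + #|Sigma| <= 2 ^ w)%N,
        wreg c 0 = addr (root T)
      & forall u s, wmem c (addr u + enum_rank s) =
          if [pick v | parent T v == Some (u, s)] is Some v then addr v
          else 0%N].

(* Main.v *)
Require Import Defs.
From mathcomp Require Import all_boot all_order all_algebra.
From mathcomp Require Import zify lra.

Set Implicit Arguments.
Unset Strict Implicit.
Unset Printing Implicit Defensive.

Import Order.TTheory GRing.Theory Num.Theory.
Local Open Scope ring_scope.

(** A string S of length at most n belongs to the trie iff core_prob S >= 1/z,
    where core_prob S is the probability of the shortest F whose extension is S.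
    Prepending a letter s to S multiplies core_prob by the probability of s,
    except that it stays 1 when s :: S is a suffix of the heavy string.  So the
    children of a node are found in O(1) time per letter from its depth, its
    core probability and a bit telling whether it is a heavy suffix, and a
    breadth-first search from the root builds the trie in time linear in its
    size.  The strings of a given length in the trie have pairwise
    prefix-incomparable maximal solid prefixes, hence there are at most z of
    them, and at most (n + 1) z nodes altogether. *)

(** * Strings of the trie: membership by core probability, and their number *)

Definition factor_prob (R : realFieldType) (Sigma : finType)
    (X : seq {ffun Sigma -> R}) (i : nat) (F : seq Sigma) : R :=
  \prod_(k < size F) X`_(i + k) (tnth (in_tuple F) k).

Lemma factor_prob_cons (R : realFieldType) (Sigma : finType)
    (X : seq {ffun Sigma -> R}) i s F :
  factor_prob X i (s :: F) = X`_i s * factor_prob X i.+1 F.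
Proof.
rewrite /factor_prob /= big_ord_recl addn0; congr (_ * _).
by apply: eq_bigr => k _; rewrite !(tnth_nth s) /= addSnnS.
Qed.

Lemma factor_prob_nil (R : realFieldType) (Sigma : finType)
    (X : seq {ffun Sigma -> R}) i :
  factor_prob X i [::] = 1.
Proof. by rewrite /factor_prob big_ord0. Qed.

Lemma extension_cons (Sigma : finType) (H : seq Sigma) i s F :
  extension H i (s :: F) = s :: extension H i.+1 F.
Proof. by rewrite /extension /= addSnnS. Qed.

Section SolidExtensions.
Variables (R : realFieldType) (Sigma : finType) (X : seq {ffun Sigma -> R}).
Variable H : seq Sigma.
Hypotheses (wX : weighted_sequence X) (hH : heavy_string X H).
Local Notation n := (size X).

(** Every extension reaches the end of [X], so the length of [S] fixes its starting position
    [n - size S]. *)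
Definition heavy_suffix (S : seq Sigma) := S == drop (n - size S) H.

(* The probability of the shortest F such that S is the extension of F. *)
Fixpoint core_prob (S : seq Sigma) : R :=
  if S is s :: S' then
    if heavy_suffix S then 1 else X`_(n - size S) s * core_prob S'
  else 1.

Definition in_trie (z : R) (S : seq Sigma) :=
  (size S <= n)%N && (z^-1 <= core_prob S).

Lemma weight_ge0 i s : (i < n)%N -> 0 <= X`_i s.
Proof. by move=> /wX[]. Qed.

Lemma weight_le1 i s : (i < n)%N -> X`_i s <= 1.
Proof.
move=> /wX[X0 <-]; rewrite (bigD1 s) //= lerDl.
by apply: sumr_ge0 => t _; apply: X0.
Qed.

Lemma factor_prob_ge0 i F : (i + size F <= n)%N -> 0 <= factor_prob X i F.
Proof.
move=> iF; apply: prodr_ge0 => k _; apply: weight_ge0.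
by apply: leq_trans iF; rewrite ltn_add2l.
Qed.

Lemma factor_prob_le1 i F : (i + size F <= n)%N -> factor_prob X i F <= 1.
Proof.
move=> iF; apply: prodr_ile1 => k _; have ik : (i + k < n)%N.
  by apply: leq_trans iF; rewrite ltn_add2l.
by rewrite weight_ge0 // weight_le1.
Qed.

Lemma heavy_suffix_nil : heavy_suffix [::].
Proof. by rewrite /heavy_suffix subn0 drop_oversize //; case: hH => ->. Qed.

Lemma heavy_suffix_cons s S : (size S < n)%N ->
  heavy_suffix (s :: S) = (s == nth s H (n - (size S).+1)) && heavy_suffix S.
Proof.
move=> ltS; rewrite /heavy_suffix /= (drop_nth s); last by case: hH => ->; lia.
by rewrite eqseq_cons; congr (_ && (_ == drop _ _)); lia.
Qed.

Lemma size_extension i F : (i + size F <= n)%N -> size (extension H i F) = (n - i)%N.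
Proof. by rewrite size_cat size_drop; case: hH => -> _; lia. Qed.

Lemma core_prob_heavy S : heavy_suffix S -> core_prob S = 1.
Proof. by case: S => //= s S ->. Qed.

(** Induction on [F]: each letter multiplies both sides by the same weight, unless the core
    probability is reset to 1, which bounds every factor probability. *)
Lemma core_prob_extension i F : (i + size F <= n)%N ->
  factor_prob X i F <= core_prob (extension H i F).
Proof.
elim: F i => [|s F IH] i iF.
  rewrite factor_prob_nil core_prob_heavy // /heavy_suffix size_extension //.
  by rewrite /extension /= addn0 subKn //; move: iF => /=; lia.
rewrite factor_prob_cons extension_cons /=; case: ifP => _.
  by rewrite -factor_prob_cons factor_prob_le1.
move: iF => /= iF; rewrite size_extension; last lia.
have -> : (n - (n - i.+1).+1 = i)%N by lia.
by rewrite ler_wpM2l ?IH ?weight_ge0 //; lia.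
Qed.

Lemma core_probP S : (size S <= n)%N -> exists2 F,
  (n - size S + size F <= n)%N /\ S = extension H (n - size S) F
  & core_prob S = factor_prob X (n - size S) F.
Proof.
have heavyE T : (size T <= n)%N -> heavy_suffix T -> exists2 F,
    (n - size T + size F <= n)%N /\ T = extension H (n - size T) F
    & core_prob T = factor_prob X (n - size T) F.
  move=> leT hT; exists [::]; last by rewrite core_prob_heavy // factor_prob_nil.
  by split; [rewrite /= ; lia | rewrite /extension /= addn0; apply/eqP].
elim: S => [|s S IH] leS; first by apply: heavyE; rewrite ?heavy_suffix_nil.
have [hS|nhS] := boolP (heavy_suffix (s :: S)); first exact: heavyE.
move: leS => /= leS; have [|F [leF SE] FE] := IH; first lia.
have nS : ((n - (size S).+1).+1 = n - size S)%N by lia.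
exists (s :: F); last by rewrite /= (negbTE nhS) factor_prob_cons /= nS FE.
by split; [rewrite /=; lia | rewrite extension_cons /= nS -SE].
Qed.

(** [core_prob S] is the largest probability of a factor with extension [S]: one factor attains it
    and none exceeds it. *)
Lemma in_trieP z S : in_trie z S <-> solid_extensions X z H S.
Proof.
split=> [/andP[leS zS]|[i [F [[iF zF] ->]]]].
  have [F [leF SE] FE] := core_probP leS.
  exists (n - size S)%N, F; split=> //; split=> //.
  by move: zS; rewrite FE.
apply/andP; split; first by rewrite size_extension //; lia.
exact: le_trans zF (core_prob_extension iF).
Qed.

(** Prepending [s] multiplies the core probability by a weight at most 1, unless [s :: S] is heavy;
    then so is [S], with core probability 1. *)
Lemma in_trie_suffix z s S : in_trie z (s :: S) -> in_trie z S.
Proof.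
case/andP=> /= ltS; rewrite /in_trie (ltnW ltS) /=; case: ifP => [|_ zS].
  by rewrite heavy_suffix_cons // => /andP[_ /core_prob_heavy->].
apply: le_trans zS _; rewrite ler_piMl ?weight_le1 //; last lia.
by have [F [leF _] ->] := core_probP (ltnW ltS); apply: factor_prob_ge0.
Qed.

(* The maximal solid factors at j form a prefix-free set, hence their
   probabilities add up to at most 1.  In the induction on the position the
   threshold y becomes y / X_j(s) after the letter s. *)
Lemma solid_extensions_count j (y : R) (L : seq (seq Sigma)) :
  (j <= n)%N -> 0 < y -> y <= 1 -> uniq L ->
  (forall S : seq Sigma, S \in L -> exists F,
     [/\ (j + size F <= n)%N, y <= factor_prob X j F & S = extension H j F]) ->
  y * (size L)%:R <= 1.
Proof.
have small (S : seq Sigma) (L' : seq (seq Sigma)) (y' : R) : y' <= 1 -> uniq L' -> {subset L' <= [:: S]} ->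
    y' * (size L')%:R <= 1.
  move=> y1 uL /(uniq_leq_size uL) /= sL.
  by case: (size L') sL => [|[|//]] _; rewrite ?mulr0 ?mulr1 ?ler01.
move=> jn; move Em: (n - j)%N => m.
elim: m j jn Em y L => [|m IH] j jn Em y L y0 y1 uL LE.
  apply: (small [::]) => // S /LE[F [jF _ ->]].
  by rewrite inE -size_eq0 size_extension // Em.
have jn' : (j < n)%N by lia.
have [s0 _] : exists s0 : Sigma, True.
  have [_ sum1] := wX jn'; case: (pickP (@predT Sigma)) => [s _|no]; first by exists s.
  by move/eqP: sum1; rewrite big_pred0 // eq_sym oner_eq0.
have dropE : drop j H = nth s0 H j :: drop j.+1 H.
  by apply: drop_nth; case: hH => ->.
pose h := nth s0 H j; have maxh s : X`_j s <= X`_j h.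
  by case: hH => szH maxH; rewrite /h (set_nth_default s) ?szH ?maxH.
(* If even the heaviest letter is too light, only the empty [F] qualifies and [L] has at most one
   string. *)
have [Xhy|yXh] := ltP (X`_j h) y.
  apply: (small (drop j H)) => // S /LE[[|s F] [jF yF ->]].
    by rewrite inE /extension addn0.
  have : factor_prob X j (s :: F) < y.
    apply: le_lt_trans Xhy; rewrite factor_prob_cons.
    apply: le_trans (maxh s); rewrite ler_piMr ?weight_ge0 //.
    by apply: factor_prob_le1; move: jF => /=; lia.
  by rewrite ltNge yF.
(* Group the strings by first letter and delete it; the bounds of the groups add up to the total
   weight 1 of position [j]. *)
pose Ls s := [seq behead (T : seq Sigma) | T <- L & ohead T == Some s].
have sizeL : size L = (\sum_s size (Ls s))%N.
  under eq_bigr => s _ do rewrite size_map size_filter -sum1_count.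
  rewrite (exchange_big_dep predT) //= -sum1_size big_seq [RHS]big_seq.
  apply: eq_bigr => S /LE[F [jF _ SE]].
  have : size S = (n - j)%N by rewrite SE size_extension.
  case: S SE => [|s S] _; first by rewrite Em.
  by rewrite (big_pred1 s) // => t /=; rewrite (inj_eq Some_inj) eq_sym.
have [_ sum1] := wX jn'; rewrite -[leRHS]sum1 sizeL natr_sum mulr_sumr; apply: ler_sum => s _.
have memLs S : S \in Ls s -> s :: S \in L.
  case/mapP => [[|t S']]; rewrite mem_filter //= => /andP[/eqP[->] LS'] ->.
  exact: LS'.
have uLs : uniq (Ls s).
  rewrite map_inj_in_uniq ?filter_uniq // => [[|s1 S1] [|s2 S2]];
    rewrite !mem_filter //= => /andP[/eqP[->] _] /andP[/eqP[->] _].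
  by move=> ->.
(* A letter lighter than [y] begins no string of [L]: a nonempty [F] would be too light, and the
   empty one has an extension starting with the heavy letter, of weight at least [y]. *)
have [ysX|Xsy] := leP y (X`_j s); last first.
  suff -> : Ls s = [::] by rewrite mulr0 weight_ge0.
  case ELs: (Ls s) => [//|S Ls']; have {ELs} : S \in Ls s by rewrite ELs inE eqxx.
  move=> /memLs/LE[[|t F] [jF yF]].
    rewrite /extension addn0 dropE => [[sE _]].
    by move: Xsy; rewrite sE ltNge yXh.
  rewrite extension_cons => [[ts _]].
  suff : y <= X`_j s by rewrite leNgt Xsy.
  apply: le_trans yF _; rewrite ts factor_prob_cons ler_piMr ?weight_ge0 //.
  by apply: factor_prob_le1; move: jF => /=; lia.
have Xs0 : 0 < X`_j s by apply: lt_le_trans y0 ysX.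
rewrite -[leRHS]mulr1 -ler_pdivrMl // mulrA [_^-1 * _]mulrC.
apply: (IH j.+1) => //; first lia; first by rewrite divr_gt0.
  by rewrite ler_pdivrMr // mul1r.
move=> S /memLs/LE[[|t F] [jF yF]].
  rewrite /extension addn0 dropE => [[_ ->]]; exists [::].
  by rewrite factor_prob_nil /= addn0 ler_pdivrMr // mul1r.
rewrite extension_cons => [[ts ->]]; exists F; split=> //.
  by move: jF => /=; lia.
by rewrite ler_pdivrMr // mulrC ts -factor_prob_cons.
Qed.

Lemma size_trie_le z (L : seq (seq Sigma)) : 1 <= z -> uniq L ->
  (forall S : seq Sigma, S \in L -> in_trie z S) -> (size L)%:R <= n.+1%:R * z.
Proof.
move=> z1 uL LE; have z0 : 0 < z by apply: lt_le_trans z1.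
pose Lj j := [seq T <- L | size T == j].
have -> : size L = (\sum_(j < n.+1) size (Lj j))%N.
  under eq_bigr => j _ do rewrite size_filter -sum1_count.
  rewrite (exchange_big_dep predT) //= -sum1_size big_seq [RHS]big_seq.
  apply: eq_bigr => S /LE/andP[leS _].
  rewrite (big_pred1 (Ordinal (leS : (size S < n.+1)%N))) //.
rewrite natr_sum -[n.+1 in leRHS]card_ord -sum1_card natr_sum mulr_suml.
apply: ler_sum => j _; rewrite mul1r -[leRHS]mulr1 -ler_pdivrMl //.
apply: (@solid_extensions_count (n - j)); rewrite ?invr_gt0 ?filter_uniq ?leq_subr //.
  by rewrite invf_le1.
move=> S; rewrite mem_filter => /andP[/eqP <- /LE/andP[leS zS]].
by have [F [leF SE] FE] := core_probP leS; exists F; rewrite -FE.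
Qed.

End SolidExtensions.

(* Word registers: 0 = the constant 1, 2 = #|Sigma|, 3 = n #|Sigma|, 11 = the
   size of a node, 12 = the constant 0, 4 and 5 = head and tail of the queue of
   nodes, 6 = offset of the current row of the input table, 7 = current
   letter, 8 = letter of the heavy child (or #|Sigma| if there is none), 9 =
   heaviness flag, 10 = address.  Probability registers: 0 = 1/z, 1 = core probability of the
   node, 2 = that of the child, 3 = maximum of the row. *)
Definition trie_program (sigma : nat) : program := [::
  WConst 2 sigma;
  WOp OpMul 3 0 2;
  WConst 0 1;
  WConst 4 1;
  WConst 11 sigma.+2;
  WOp OpAdd 10 4 2;
  WStore 10 3;
  WOp OpAdd 10 10 0;
  WStore 10 0;
  POne 1;
  WOp OpAdd 10 4 3;
  PStore 10 1;
  WOp OpAdd 5 4 11;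
  (* 13: next node of the queue *)
  JumpEq 4 5 60;
  WOp OpAdd 10 4 2;
  WLoad 6 10;
  JumpEq 6 12 58;
  WOp OpSub 6 6 2;
  WOp OpAdd 10 10 0;
  WLoad 9 10;
  WOp OpAdd 10 4 3;
  PLoad 1 10;
  WConst 7 0;
  WOp OpAdd 8 2 12;
  JumpEq 9 12 36;
  WConst 8 0;
  PLoad 3 6;
  (* 27: argmax of the row *)
  JumpEq 7 2 35;
  WOp OpAdd 10 6 7;
  PLoad 2 10;
  PJumpLe 2 3 33;
  PLoad 3 10;
  WOp OpAdd 8 7 12;
  WOp OpAdd 7 7 0;
  Jump 27;
  WConst 7 0;
  (* 36: children of the node *)
  JumpEq 7 2 58;
  WOp OpAdd 10 6 7;
  PLoad 2 10;
  PMul 2 2 1;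
  WConst 9 0;
  JumpEq 7 8 43;
  Jump 45;
  POne 2;
  WConst 9 1;
  PJumpLe 0 2 47;
  Jump 56;
  WOp OpAdd 10 4 7;
  WStore 10 5;
  WOp OpAdd 10 5 2;
  WStore 10 6;
  WOp OpAdd 10 10 0;
  WStore 10 9;
  WOp OpAdd 10 5 3;
  PStore 10 2;
  WOp OpAdd 5 5 11;
  WOp OpAdd 7 7 0;
  Jump 36;
  (* 58: end of the loop body *)
  WOp OpAdd 4 4 11;
  Jump 13].

(** * Execution in bounded time, word arithmetic, and the maximum of a row *)

Lemma runS (R : realFieldType) (P : program) w t (c : config R) :
  run P w t.+1 c = run P w t (step P w c).
Proof. exact: iterSr. Qed.

Arguments run : simpl never.
Arguments eval_op : simpl never.

(** An upper bound rather than an exact time lets branches of different lengths share one budget. *)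
Definition reaches (R : realFieldType) (P : program) w K (c : config R)
    (Q : config R -> Prop) := exists2 t, (t <= K)%N & Q (run P w t c).

Lemma reaches_now (R : realFieldType) P w K (c : config R) (Q : config R -> Prop) :
  Q c -> reaches P w K c Q.
Proof. by exists 0%N. Qed.

Lemma reaches_step (R : realFieldType) P w K (c : config R) (Q : config R -> Prop) :
  reaches P w K (step P w c) Q -> reaches P w K.+1 c Q.
Proof. by case=> t tK Qt; exists t.+1 => //; rewrite runS. Qed.

Lemma reaches_seq (R : realFieldType) P w K1 K2 K (c : config R)
    (Q1 Q : config R -> Prop) :
  (K1 + K2 <= K)%N -> reaches P w K1 c Q1 ->
  (forall c', Q1 c' -> reaches P w K2 c' Q) -> reaches P w K c Q.
Proof.
move=> K12 [t1 tK1 Qt1] /(_ _ Qt1)[t2 tK2 Qt2]; exists (t2 + t1)%N; first lia.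
by rewrite /run iterD.
Qed.

Lemma reaches_le (R : realFieldType) P w K1 K (c : config R) (Q : config R -> Prop) :
  (K1 <= K)%N -> reaches P w K1 c Q -> reaches P w K c Q.
Proof. by move=> K1K [t tK Qt]; exists t => //; apply: leq_trans K1K. Qed.

Lemma eval_add w a b : (a + b < 2 ^ w)%N -> eval_op w OpAdd a b = (a + b)%N.
Proof. exact: modn_small. Qed.

Lemma eval_mul w a b : (a * b < 2 ^ w)%N -> eval_op w OpMul a b = (a * b)%N.
Proof. exact: modn_small. Qed.

Lemma eval_sub w a b : (b <= a < 2 ^ w)%N -> eval_op w OpSub a b = (a - b)%N.
Proof.
case/andP=> ba aw; rewrite /eval_op addnC -addnBA // addnC modnDr modn_small //.
by lia.
Qed.

(** This mirrors the scan of the program, the smaller index winning ties, so that a heavy string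
    defined with it is the one found by the machine. *)
Fixpoint argmax (R : realFieldType) (f : nat -> R) (k : nat) : nat :=
  if k is k'.+1 then
    if f k' <= f (argmax f k') then argmax f k' else k'
  else 0.

Lemma argmax_lt (R : realFieldType) (f : nat -> R) k : (0 < k)%N -> (argmax f k < k)%N.
Proof.
elim: k => //= -[_ _|k /(_ isT) IH _]; first by case: ifP.
by case: ifP => // _; apply: ltnW.
Qed.

Lemma argmaxP (R : realFieldType) (f : nat -> R) k j : (j < k)%N -> f j <= f (argmax f k).
Proof.
elim: k => //= k IH; rewrite ltnS leq_eqVlt => /predU1P[->|/IH fj].
  by case: ifP.
by case: ifP => // /negbT; rewrite -ltNge => /ltW; apply: le_trans.
Qed.

Lemma eq_argmax (R : realFieldType) (f g : nat -> R) k :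
  (forall j, (j < k)%N -> f j = g j) -> argmax f k = argmax g k.
Proof.
elim: k => //= k IH fg; rewrite IH => [|j jk]; last by apply: fg; lia.
case: k IH fg => [|k] _ fg; first by rewrite !fg.
by rewrite !fg // ltnW // ltnS argmax_lt.
Qed.

Lemma nth_table (R : realFieldType) (Sigma : finType) (X : seq {ffun Sigma -> R}) i s :
  (i < size X)%N ->
  [seq (x : {ffun Sigma -> R}) t | x <- X, t <- enum Sigma]`_(i * #|Sigma| + enum_rank s)
  = X`_i s.
Proof.
elim: X i => [|x X IH] [|i] //= iX; rewrite nth_cat size_map -cardE.
  by rewrite mul0n add0n ltn_ord (nth_map s) -?cardE // nth_enum_rank.
rewrite mulSn -addnA ltnNge leq_addr /= addKn; exact: IH.
Qed.

(** * Invariants of the breadth-first search *)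

Section Run.
Variables (R : realFieldType) (Sigma : finType) (X : seq {ffun Sigma -> R}).
Variables (H : seq Sigma) (z : R) (w sigma : nat).
Local Notation n := (size X).
Local Notation prog := (trie_program sigma).

(* The k-th node takes sigma + 2 words: the pointers to its children, the
   offset in the input table of the row of its first letter (the end of the
   table for the root), and its heaviness flag.  Its core probability is stored
   at the same address, shifted by the size n sigma of the table. *)
Definition adr k := (1 + sigma.+2 * k)%N.

Hypotheses (sigmaE : #|Sigma| = sigma) (sigma_gt0 : (0 < sigma)%N).
Hypotheses (wX : weighted_sequence X) (hH : heavy_string X H) (z1 : 1 <= z).
Hypothesis argmaxH : forall i s0, (i < n)%N ->
  enum_rank (nth s0 H i) = argmax (fun k => X`_i (nth s0 (enum Sigma) k)) sigma :> nat.
(** Asked for every list of trie strings because the list of nodes grows; the extra block is the one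
    being allocated at the tail of the queue. *)
Hypothesis enough_words : forall L : seq (seq Sigma),
  uniq L -> (forall S : seq Sigma, S \in L -> in_trie X H z S) ->
  (adr (size L).+1 + n * sigma < 2 ^ w)%N.

Definition env (r : nat -> nat) (q : nat -> R) :=
  [/\ r 0 = 1, r 2 = sigma, r 3 = n * sigma, r 11 = sigma.+2 & r 12 = 0]%N
  /\ q 0%N = z^-1.

(* L lists the strings of the allocated nodes in the order of their addresses;
   the nodes before the k-th one are done, and so are the first a letters of
   the k-th one. *)
Record list_inv (L : seq (seq Sigma)) (k a : nat) : Prop := ListInv {
  list_uniq : uniq L;
  list_root : index [::] L = 0%N;
  list_nil : [::] \in L;
  list_sub : forall S : seq Sigma, S \in L -> in_trie X H z S;
  list_suffix : forall s u, s :: u \in L -> u \in L;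
  list_mem : forall s u, u \in L -> (s :: u \in L) =
    ((index u L < k) || (index u L == k) && (enum_rank s < a))%N
    && in_trie X H z (s :: u)
}.

(** [mem_free] makes the child pointers of a fresh node null without initialisation; [mem_table]
    says that the input survives, core probabilities being stored past it. *)
Record mem_inv (L : seq (seq Sigma)) (m : nat -> nat) (p : nat -> R) : Prop := MemInv {
  mem_child : forall s u, u \in L -> m (adr (index u L) + enum_rank s)%N =
    if s :: u \in L then adr (index (s :: u) L) else 0%N;
  mem_row : forall u, u \in L ->
    m (adr (index u L) + sigma)%N = ((n - size u) * sigma)%N;
  mem_flag : forall u, u \in L -> m (adr (index u L) + sigma.+1)%N = heavy_suffix X H u;
  mem_prob : forall u, u \in L -> p (adr (index u L) + n * sigma)%N = core_prob X H u;
  mem_free : forall x, (adr (size L) <= x)%N -> m x = 0%N;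
  mem_table : forall i s, (i < n)%N -> p (i * sigma + enum_rank s)%N = X`_i s
}.

Lemma rank_lt (s : Sigma) : (enum_rank s < sigma)%N.
Proof. by rewrite -sigmaE ltn_ord. Qed.

(** Block number and offset are a quotient and a remainder by the block length [sigma.+2]. *)
Lemma adr_inj k l x y : (x < sigma.+2)%N -> (y < sigma.+2)%N ->
  ((adr k + x == adr l + y) = (k == l) && (x == y))%N.
Proof.
move=> xs ys; apply/eqP/andP => [E|[/eqP-> /eqP->//]].
have {}E : (k * sigma.+2 + x = l * sigma.+2 + y)%N by rewrite /adr in E; lia.
have kl : k = l.
  have := congr1 (divn^~ sigma.+2) E.
  by rewrite !divnMDl // !divn_small // !addn0.
by split; apply/eqP => //; move: E; rewrite kl; lia.
Qed.

Lemma list_inv_skip L k a s : list_inv L k a -> (k < size L)%N ->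
  enum_rank s = a :> nat -> ~~ in_trie X H z (s :: nth [::] L k) ->
  list_inv L k a.+1.
Proof.
case=> uL rL nL sL fL mL kL sa nE; split=> // t u Lu; rewrite mL // ltnS.
have [//|//|iu] := ltngtP (index u L) k; rewrite /=.
have [/val_inj/enum_rank_inj -> |] := eqVneq (enum_rank t : nat) (enum_rank s).
  by move: nE; rewrite -iu nth_index // => /negbTE->; rewrite !andbF.
by move=> ts; rewrite [in RHS]leq_eqVlt -sa (negbTE ts).
Qed.

Lemma list_inv_next L k : list_inv L k sigma -> list_inv L k.+1 0.
Proof.
case=> uL rL nL sL fL mL; split=> // t u Lu; rewrite mL // ltnS andbF orbF rank_lt andbT.
by rewrite orbC -leq_eqVlt.
Qed.

Lemma list_inv_leaf L k : list_inv L k 0 -> (k < size L)%N ->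
  size (nth [::] L k) = n -> list_inv L k sigma.
Proof.
case=> uL rL nL sL fL mL kL sk; split=> // t u Lu; rewrite mL // andbF orbF rank_lt.
have [//|//|iu] := ltngtP (index u L) k.
suff /negbTE-> : ~~ in_trie X H z (t :: u) by [].
by rewrite /in_trie /= -{1}sk -iu nth_index // ltnn.
Qed.

Lemma list_inv_new L k a s : list_inv L k a -> (k < size L)%N ->
  enum_rank s = a :> nat -> s :: nth [::] L k \notin L.
Proof.
case=> uL rL nL sL fL mL kL sa; rewrite mL ?mem_nth // index_uniq // sa.
by rewrite !ltnn andbF.
Qed.

Lemma list_inv_add L k a s : list_inv L k a -> (k < size L)%N ->
  enum_rank s = a :> nat -> in_trie X H z (s :: nth [::] L k) ->
  list_inv (rcons L (s :: nth [::] L k)) k a.+1.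
Proof.
move=> IL kL sa E; have new := list_inv_new IL kL sa.
set u := nth [::] L k in E new *; have Lu : u \in L by apply: mem_nth.
case: IL => uL rL nL sL fL mL.
have idx v : v \in L -> index v (rcons L (s :: u)) = index v L.
  by move=> Lv; rewrite -cats1 index_cat Lv.
split.
- by rewrite rcons_uniq new.
- by rewrite idx.
- by rewrite mem_rcons inE nL orbT.
- by move=> S; rewrite mem_rcons inE => /predU1P[->|/sL].
- move=> t v; rewrite !mem_rcons !inE => /predU1P[[_ ->]|/fL->]; last by rewrite orbT.
  by rewrite Lu orbT.
move=> t v; rewrite !mem_rcons !inE => /predU1P[->|Lv].
  have -> : index (s :: u) (rcons L (s :: u)) = size L.
    by rewrite -cats1 index_cat (negbTE new) /= eqxx addn0.
  rewrite ltnNge (ltnW kL) /= gtn_eqF //=.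
  (* The new node has no listed child: by suffix closure, such a child in [L] would already put
     [s :: u] in [L]. *)
  apply/negbTE; rewrite negb_or; apply/andP; split.
    by apply/eqP => -[_ /(congr1 size)/=]; lia.
  by apply/negP => /fL; rewrite (negbTE new).
rewrite idx // mL // eqseq_cons.
have -> : (v == u) = (index v L == k).
  apply/eqP/eqP => [->|iv]; first by rewrite index_uniq.
  by rewrite /u -iv nth_index.
have [//|//|iv] := ltngtP (index v L) k; rewrite ?andbF //= andbT.
have -> : v = u by rewrite /u -iv nth_index.
have [->|ts] := eqVneq t s; first by rewrite sa ltnSn E.
by rewrite ltnS [in RHS]leq_eqVlt -sa (inj_eq val_inj) (inj_eq enum_rank_inj) (negbTE ts).
Qed.

Lemma adrS k : adr k.+1 = (adr k + sigma.+2)%N.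
Proof. by rewrite /adr mulnS; lia. Qed.

(** The three word writes of an allocation hit distinct cells by [adr_inj]; the other pointers of
    the new block are null by [mem_free]. *)
Lemma mem_inv_add (L : seq (seq Sigma)) m p (u : seq Sigma) s x :
  (forall t (v : seq Sigma), t :: v \in L -> v \in L) ->
  u \in L -> s :: u \notin L -> mem_inv L m p ->
  x = core_prob X H (s :: u) ->
  mem_inv (rcons L (s :: u))
    [eta [eta [eta m with (adr (index u L) + enum_rank s)%N |-> adr (size L)]
        with (adr (size L) + sigma)%N |-> ((n - (size u).+1) * sigma)%N]
      with (adr (size L) + sigma.+1)%N |-> heavy_suffix X H (s :: u) : nat]
    [eta p with (adr (size L) + n * sigma)%N |-> x].
Proof.
move=> fL Lu new [cM rM hM pM eM tM] ->.
have idx v : v \in L -> index v (rcons L (s :: u)) = index v L.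
  by move=> Lv; rewrite -cats1 index_cat Lv.
have idxn : index (s :: u) (rcons L (s :: u)) = size L.
  by rewrite -cats1 index_cat (negbTE new) /= eqxx addn0.
have rk := rank_lt.
have iL v : v \in L -> (index v L == size L) = false.
  by rewrite -index_mem => /ltn_eqF.
split.
- move=> t v Lv; have := rk t => ts.
  have ts2 : (enum_rank t < sigma.+2)%N by rewrite !ltnS ltnW // ltnW.
  have ss2 : (enum_rank s < sigma.+2)%N by have := rk s; lia.
  rewrite /= !adr_inj //.
  have -> : (enum_rank t == sigma.+1 :> nat)%N = false by apply/eqP; lia.
  have -> : (enum_rank t == sigma :> nat)%N = false by apply/eqP; lia.
  rewrite !andbF.
  move: Lv; rewrite mem_rcons inE => /predU1P[->|Lv].
    rewrite idxn.
    rewrite [size L == _]eq_sym iL //= eM ?leq_addr //.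
    rewrite mem_rcons inE ifN // negb_or; apply/andP; split.
      by apply/eqP => -[_ /(congr1 size)/=]; lia.
    by apply/negP => /fL; rewrite (negbTE new).
  rewrite [index v _]idx // mem_rcons inE eqseq_cons.
  have -> : (index v L == index u L) = (v == u).
    by apply/eqP/eqP => [/(congr1 (nth [::] L))|->//]; rewrite !nth_index.
  rewrite andbC (inj_eq val_inj) (inj_eq enum_rank_inj).
  case: eqVneq => [->|_] /=.
    by case: eqVneq => [->|_] /=; [rewrite idxn | rewrite cM //; case: ifP => // /idx->].
  by rewrite cM //; case: ifP => // /idx->.
- move=> v Lv; have ss2 : (enum_rank s < sigma.+2)%N by have := rk s; lia.
  rewrite /= !adr_inj // (ltn_eqF (ltnSn _)) (gtn_eqF (rk s)) !andbF eqxx andbT.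
  move: Lv; rewrite mem_rcons inE => /predU1P[->|Lv]; first by rewrite idxn eqxx.
  by rewrite idx // iL // rM.
- move=> v Lv; have ss2 : (enum_rank s < sigma.+2)%N by have := rk s; lia.
  rewrite /= !adr_inj // (gtn_eqF (ltnSn _)) (gtn_eqF (leqW (rk s))).
  rewrite !andbF eqxx andbT.
  move: Lv; rewrite mem_rcons inE => /predU1P[->|Lv]; first by rewrite idxn eqxx.
  by rewrite idx // iL // hM.
- move=> v; rewrite /= eqn_add2r mem_rcons inE => /predU1P[->|Lv].
    by rewrite idxn eqxx.
  rewrite idx // -(addn0 (adr _)) -(addn0 (adr (size L))) adr_inj // iL //= addn0.
  exact: pM.
- move=> x'; rewrite size_rcons adrS => sx.
  have ix : (adr (index u L) + sigma.+2 <= adr (size L))%N.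
    by rewrite -adrS leq_add2l leq_mul2l index_mem Lu orbT.
  have lt1 : (adr (index u L) + enum_rank s < x')%N.
    apply: leq_trans (leq_trans ix (leq_trans (leq_addr _ _) sx)).
    by rewrite ltn_add2l ltnW // !ltnS ltnW.
  have lt2 : (adr (size L) + sigma < x')%N by apply: leq_trans sx; rewrite ltn_add2l.
  have lt3 : (adr (size L) + sigma.+1 < x')%N by apply: leq_trans sx; rewrite ltn_add2l.
  rewrite /= (gtn_eqF lt3) (gtn_eqF lt2) (gtn_eqF lt1) eM //.
  exact: leq_trans (leq_addr _ _) sx.
move=> i t i_n; rewrite /= ltn_eqF ?tM //.
apply: leq_trans (leq_addl _ _); apply: leq_trans (leq_mul i_n (leqnn _)).
by rewrite mulSn addnC ltn_add2r.
Qed.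

(** * Execution of the program, loop by loop *)

Definition state l L k a (c : config R) := exists r m q p,
  [/\ c = Config l r m q p, env r q, r 4%N = adr k /\ r 5%N = adr (size L),
      list_inv L k a & mem_inv L m p].

Lemma words_gt : (sigma.+3 + n * sigma < 2 ^ w)%N.
Proof. by have := @enough_words [::] isT (fun _ => ltac:(by [])); rewrite /adr /=; lia. Qed.

Lemma start_run : reaches prog w 13 (input X z) (state 13 [:: [::]] 0 0).
Proof.
have gtw := words_gt.
have w1 : (1 < 2 ^ w)%N by lia.
have wS : (sigma < 2 ^ w)%N by lia.
have wS2 : (sigma.+2 < 2 ^ w)%N by lia.
have wn : (n * sigma < 2 ^ w)%N by lia.
have wa : (1 + sigma < 2 ^ w)%N by lia.
have wa1 : (1 + sigma + 1 < 2 ^ w)%N by lia.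
have wan : (1 + n * sigma < 2 ^ w)%N by lia.
have wa2 : (1 + sigma.+2 < 2 ^ w)%N by lia.
do 13!(apply: reaches_step; rewrite /step /=
  ?(modn_small w1) ?(modn_small wS) ?(modn_small wS2)
  ?(eval_mul wn) ?(eval_add wa) ?(eval_add wa1) ?(eval_add wan) ?(eval_add wa2)).
apply: reaches_now; do 4!eexists; split; first by [].
- by [].
- by rewrite /= /adr muln0 muln1.
- split=> //=.
  + by move=> S; rewrite inE => /eqP->; rewrite /in_trie /= invf_le1 // (lt_le_trans _ z1).
  + by move=> s u _; rewrite inE ltn0 !andbF.
have rk := rank_lt.
split.
- move=> s u; rewrite inE => /eqP-> /=; rewrite /adr muln0 addn0 -addnA !eqn_add2l addn1.
  by rewrite (ltn_eqF (rk s)) (ltn_eqF (leqW (rk s))).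
- move=> u; rewrite inE => /eqP-> /=; rewrite /adr muln0 addn0 -addnA !eqn_add2l addn1.
  by rewrite (ltn_eqF (ltnSn _)) eqxx subn0.
- move=> u; rewrite inE => /eqP-> /=.
  by rewrite /adr muln0 addn0 -addnA !eqn_add2l addn1 eqxx heavy_suffix_nil.
- by move=> u; rewrite inE => /eqP-> /=; rewrite /adr muln0 addn0 eqxx.
- move=> x /= xge; rewrite !ifN //; apply/eqP; move: xge; rewrite /adr /=; lia.
move=> i s i_n /=; rewrite ltn_eqF; first by rewrite -sigmaE nth_table.
apply: (@leq_trans (n * sigma)); last exact: leq_addl.
apply: leq_trans (leq_mul i_n (leqnn _)).
by rewrite mulSn addnC ltn_add2r.
Qed.

(** With [b] letters left, an iteration takes at most 8 instructions, the worst case being an update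
    of the maximum; the last unit pays for the exit test. *)
Lemma arg_loop b a r m q p (v1 : R) v4 v5 v6 :
  let f k := p (v6 + k)%N in
  (a + b = sigma)%N -> (v6 + sigma < 2 ^ w)%N -> env r q ->
  [/\ r 4 = v4, r 5 = v5, r 6 = v6, r 7 = a & r 8 = argmax f a]%N ->
  q 1%N = v1 -> q 3%N = f (argmax f a) ->
  reaches prog w (8 * b + 1) (Config 27 r m q p) (fun c => exists r q,
    [/\ c = Config 35 r m q p, env r q, q 1%N = v1 &
     [/\ r 4 = v4, r 5 = v5, r 6 = v6 & r 8 = argmax f sigma]%N]).
Proof.
move=> f; elim: b a r q => [|b IH] a r q ab v6w er [r4 r5 r6 r7 r8] q1 q3.
  apply: (@reaches_le _ _ _ 1) => //; apply: reaches_step; rewrite /step /=.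
  have [[_ r2 _ _ _] _] := er; rewrite r7 r2 -ab addn0 eqxx.
  apply: reaches_now; exists r, q; split=> //; split=> //.
have [[r0 r2 r3 r11 r12] q0] := er.
apply: (@reaches_le _ _ _ (8 * b + 1).+4.+4); first lia.
apply: reaches_step; rewrite /step /= r7 r2 ltn_eqF; last lia.
apply: reaches_step; rewrite /step /= r6 r7 eval_add; last lia.
apply: reaches_step; rewrite /step /=.
apply: reaches_step; rewrite /step /= q3 -/(f a).
case: ifP => fa.
  apply: reaches_step; rewrite /step /= r7 r0 eval_add; last lia.
  apply: reaches_step; rewrite /step /=.
  apply: (@reaches_le _ _ _ (8 * b + 1)); first lia.
  apply: (IH a.+1) => //=; first lia.
    by split=> //; rewrite ?addn1 // r8 /= fa.
  by rewrite fa.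
apply: reaches_step; rewrite /step /=.
apply: reaches_step; rewrite /step /= r7 r12 eval_add ?addn0; last lia.
apply: reaches_step; rewrite /step /= r7 r0 eval_add; last lia.
apply: reaches_step; rewrite /step /=.
apply: (IH a.+1) => //=; first lia.
  by split=> //; rewrite ?addn1 ?fa.
by rewrite fa.
Qed.

(** [v8] is the rank of the letter leading to a heavy child, or [sigma], the rank of no letter, when
    [u] is not heavy; [child_heavy] covers both cases. *)
Record child_inv u v8 L k a r m q p : Prop := ChildInv {
  child_k : (k < size L)%N;
  child_u : nth [::] L k = u;
  child_size : (size u < n)%N;
  child_env : env r q;
  child_reg : [/\ r 4 = adr k, r 5 = adr (size L),
    r 6 = (n - (size u).+1) * sigma, r 7 = a & r 8 = v8]%N;
  child_prob : q 1%N = core_prob X H u;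
  child_heavy : forall s : Sigma, (enum_rank s == v8 :> nat) = heavy_suffix X H (s :: u);
  child_list : list_inv L k a;
  child_mem : mem_inv L m p
}.

Lemma list_words L k a : list_inv L k a ->
  (adr (size L) + sigma.+2 + n * sigma < 2 ^ w)%N.
Proof. by case=> uL _ _ sL _ _; rewrite -adrS enough_words. Qed.

Lemma leq_adr k l : (adr k <= adr l)%N = (k <= l)%N.
Proof. by rewrite /adr leq_add2l leq_pmul2l. Qed.

(** At label 45 the flag and core probability of the child are known; since [size u < n], the
    comparison with [1/z] decides membership in the trie. *)
Lemma child_alloc u v8 L k s r m q p :
  child_inv u v8 L k (enum_rank s) r m q p ->
  r 9%N = heavy_suffix X H (s :: u) -> q 2%N = core_prob X H (s :: u) ->
  reaches prog w 13 (Config 45 r m q p) (fun c => exists L' r m q p,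
    [/\ c = Config 36 r m q p, (size L <= size L')%N &
        child_inv u v8 L' k (enum_rank s).+1 r m q p]).
Proof.
case=> kL Eu su [[r0 r2 r3 r11 r12] q0] [r4 r5 r6 r7 r8] q1 hv IL IM r9 q2.
have wL := list_words IL; have sa := rank_lt s.
move Ea: (nat_of_ord (enum_rank s)) => a in r7 IL sa *.
have kL' : (adr k + sigma.+2 <= adr (size L))%N by rewrite -adrS leq_adr.
apply: reaches_step; rewrite /step /= q0 q2; case: ifP => E.
  do 11!(apply: reaches_step; rewrite /step /= ?(r0, r2, r3, r4, r5, r6, r7, r9, r11)
    ?eval_add; try lia).
  apply: reaches_now; exists (rcons L (s :: u)); do 4!eexists; split; first by [].
    by rewrite size_rcons.
  have inE : in_trie X H z (s :: nth [::] L k) by rewrite Eu /in_trie su E.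
  split=> //=.
  - by rewrite size_rcons ltnW.
  - by rewrite nth_rcons kL.
  - by rewrite size_rcons adrS addn1.
  - by rewrite -Eu; apply: list_inv_add.
  have Lu : u \in L by rewrite -Eu mem_nth.
  have new : s :: u \notin L by rewrite -Eu (list_inv_new IL).
  have ku : index u L = k by rewrite -Eu index_uniq //; case: IL.
  have := mem_inv_add (list_suffix IL) Lu new IM erefl.
  by rewrite ku Ea q2 addn1 addnS.
do 3!(apply: reaches_step; rewrite /step /= ?r7 ?r0 ?eval_add; try lia).
apply: reaches_now; exists L; do 4!eexists; split; first by [].
  by [].
split=> //=; first by rewrite addn1.
by apply: (list_inv_skip IL kL Ea); rewrite Eu /in_trie E andbF.
Qed.

Lemma exists_letter a : (a < sigma)%N -> exists s : Sigma, enum_rank s = a :> nat.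
Proof.
rewrite -sigmaE => a_lt; exists (enum_val (Ordinal a_lt)).
by rewrite enum_valK.
Qed.

Lemma row_words L k a i : list_inv L k a -> (i < n)%N ->
  (i * sigma + sigma < 2 ^ w)%N.
Proof.
move=> /list_words wL i_n; apply: leq_ltn_trans wL.
by rewrite addnC -mulSn; apply: leq_trans (leq_addl _ _); rewrite leq_mul2r i_n orbT.
Qed.

Lemma child_loop b u v8 L k a r m q p : (a + b = sigma)%N ->
  child_inv u v8 L k a r m q p ->
  reaches prog w (22 * b + 1) (Config 36 r m q p) (fun c => exists2 L',
    (size L <= size L')%N & state 58 L' k sigma c).
Proof.
elim: b L a r m q p => [|b IH] L a r m q p ab CI.
  have [kL Eu su [[r0 r2 r3 r11 r12] q0] [r4 r5 r6 r7 r8] q1 hv IL IM] := CI.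
  apply: reaches_step; rewrite /step /= r7 r2 -ab addn0 eqxx.
  by apply: reaches_now; exists L => //; exists r, m, q, p; split=> //; rewrite -ab addn0.
have [s sa] : exists s : Sigma, enum_rank s = a :> nat by apply: exists_letter; lia.
(* At most 8 instructions lead to label 45, and [child_alloc] takes 13. *)
apply: (@reaches_seq _ _ _ 21 (22 * b + 1) _ _ (fun c => exists L' r m q p,
    [/\ c = Config 36 r m q p, (size L <= size L')%N &
        child_inv u v8 L' k a.+1 r m q p])) => [||_ [L' [r' [m' [q' [p' [-> LL' CI']]]]]]].
- lia.
- have [kL Eu su [[r0 r2 r3 r11 r12] q0] [r4 r5 r6 r7 r8] q1 hv IL IM] := CI.
  have wr := row_words IL (_ : n - (size u).+1 < n)%N.
  have {wr} wr : ((n - (size u).+1) * sigma + sigma < 2 ^ w)%N by apply: wr; lia.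
  have as_ : (a < sigma)%N by lia.
  have px : p ((n - (size u).+1) * sigma + a)%N = X`_(n - (size u).+1) s.
    by rewrite -sa (mem_table IM) //; lia.
  do 6!(apply: reaches_step; rewrite /step /= ?(r6, r7, r8, px, q1, mod0n) ?r2
    ?(ltn_eqF as_) ?eval_add; try lia).
  have w1 : (1 < 2 ^ w)%N by have := words_gt; lia.
  rewrite -sa (hv s); case: ifP => hs.
    do 2!(apply: reaches_step; rewrite /step /= ?modn_small //).
    apply: (child_alloc (u := u) (v8 := v8) (k := k)).
    + by split=> //=; rewrite ?sa.
    + by rewrite /= hs.
    + by rewrite /= hs.
  apply: reaches_step; rewrite /step /=.
  apply: (@reaches_le _ _ _ 13) => //.
  apply: (child_alloc (u := u) (v8 := v8) (k := k)).
  + by split=> //=; rewrite ?sa.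
  + by rewrite /= hs.
  + by rewrite /= hs.
case: (IH _ _ _ _ _ _ _ CI'); first lia.
move=> t tle [L'' LL'' st]; exists t => //; exists L'' => //.
exact: leq_trans LL''.
Qed.

Lemma state_next L k c : state 58 L k sigma c -> (k < size L)%N ->
  reaches prog w 2 c (state 13 L k.+1 0).
Proof.
case=> r [m [q [p [-> [[r0 r2 r3 r11 r12] q0] [r4 r5] IL IM]]]] kL.
have wL := list_words IL.
have kL' : (adr k + sigma.+2 <= adr (size L))%N by rewrite -adrS leq_adr.
do 2!(apply: reaches_step; rewrite /step /= ?r4 ?r11 ?eval_add; try lia).
apply: reaches_now; do 4!eexists; split; first by [].
- by [].
- by rewrite /= adrS.
- exact: list_inv_next.
- by [].
Qed.

(** The budget is 8 per letter for the maximum of the row, 22 per letter for the children, and a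
    constant. *)
Lemma next_node L k c : state 13 L k 0 c -> (k < size L)%N ->
  reaches prog w (30 * sigma + 30) c (fun c => exists2 L',
    (size L <= size L')%N & state 13 L' k.+1 0 c).
Proof.
case=> r [m [q [p [-> er [r4 r5] IL IM]]]] kL.
apply: (@reaches_seq _ _ _ (30 * sigma + 28) 2 _ _ (fun c => exists2 L',
    (size L <= size L')%N & state 58 L' k sigma c)) => [||c' [L' LL' st]]; first lia; last first.
  have [t tle st'] := state_next st (leq_trans kL LL').
  by exists t => //; exists L'.
have [[r0 r2 r3 r11 r12] q0] := er.
have wL := list_words IL; have gtw := words_gt.
have kL' : (adr k + sigma.+2 <= adr (size L))%N by rewrite -adrS leq_adr.
move Eu: (nth [::] L k) => u.
have Lu : u \in L by rewrite -Eu mem_nth.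
have ku : index u L = k by rewrite -Eu index_uniq //; case: IL.
have su : (size u <= n)%N by have /andP[] := list_sub IL Lu.
have := mem_row IM Lu; have := mem_flag IM Lu; have := mem_prob IM Lu.
rewrite ku addnS -addn1 => pu hu ru.
have ak : (adr k < adr (size L))%N by lia.
apply: (@reaches_le _ _ _ (30 * sigma + 14).+4.+4.+4); first lia.
apply: reaches_step; rewrite /step /= r4 r5 (ltn_eqF ak).
do 2!(apply: reaches_step; rewrite /step /= ?r4 ?r2 ?eval_add; try lia).
rewrite ru; apply: reaches_step; rewrite /step /= r12 muln_eq0.
(* The stored row offset vanishes exactly when [size u = n]; then no letter can be prepended. *)
rewrite [sigma == _]gtn_eqF // orbF; case: ifP => [|/negbT] leaf.
  apply: reaches_now; exists L => //; do 4!eexists; split; first by [].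
  - by split.
  - by split.
  - by apply: list_inv_leaf => //; rewrite Eu; move: leaf; rewrite subn_eq0 => leaf; lia.
  - by [].
have {leaf}su : (size u < n)%N by lia.
have wr : ((n - (size u).+1) * sigma + sigma < 2 ^ w)%N by apply: row_words IL _; lia.
have nS : ((n - size u) * sigma = (n - (size u).+1) * sigma + sigma)%N.
  by rewrite addnC -mulSn; congr (_ * _)%N; lia.
have ws := introT andP (conj (leq_addl ((n - (size u).+1) * sigma)%N sigma) wr).
do 7!(apply: reaches_step; rewrite /step /= ?(r0, r2, r3, r4, r12, hu, pu, nS, mod0n)
  ?(eval_sub ws) ?addnK ?eval_add; try lia).
set i := (n - (size u).+1)%N in wr nS *.
apply: reaches_step; rewrite /step /= ?r12 eqb0; case: ifP => [hs|/negbFE hs].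
  apply: (@reaches_le _ _ _ (22 * sigma + 1)); first lia.
  apply: (child_loop (u := u) (v8 := sigma) (a := 0)); first by rewrite add0n.
  split=> //=; first by split=> //; rewrite addn0.
  by move=> s; rewrite (ltn_eqF (rank_lt s)) (heavy_suffix_cons hH) // (negbTE hs) andbF.
apply: (@reaches_le _ _ _ (30 * sigma + 12).+2); first lia.
do 2!(apply: reaches_step; rewrite /step /= ?mod0n).
pose f j := p (i * sigma + j)%N.
apply: (@reaches_seq _ _ _ (8 * sigma + 1) (22 * sigma + 2) _ _ (fun c => exists r q,
    [/\ c = Config 35 r m q p, env r q, q 1%N = core_prob X H u &
     [/\ r 4 = adr k, r 5 = adr (size L), r 6 = i * sigma & r 8 = argmax f sigma]%N])).
- lia.
- apply: (arg_loop (a := 0)) => //=; last by rewrite addn0.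
move=> _ [r' [q' [-> er' q1' [r4' r5' r6' r8']]]].
apply: (@reaches_le _ _ _ (22 * sigma + 1).+1); first lia.
apply: reaches_step; rewrite /step /= mod0n.
apply: (child_loop (u := u) (v8 := argmax f sigma) (a := 0)); first by rewrite add0n.
(* For a heavy [u] the heavy child comes from the letter of [H], which [argmaxH] identifies with the
   maximum found in the row. *)
split=> //= s; rewrite (heavy_suffix_cons hH) // hs andbT -(inj_eq enum_rank_inj) -(inj_eq val_inj).
congr (_ == _); rewrite /= argmaxH; last by rewrite /i; lia.
apply: eq_argmax => j /exists_letter[t <-].
by rewrite nth_enum_rank /f (mem_table IM) // /i; lia.
Qed.

(** The queue grows during the loop, so termination comes from the word size: the addresses of
    listed nodes fit in words, whence [k < 2 ^ w], and [d] is the fuel. The cost is charged to the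
    final list. *)
Lemma all_nodes d L k c : (2 ^ w - k <= d)%N -> (k <= size L)%N -> state 13 L k 0 c ->
  exists2 L', (k <= size L')%N &
    reaches prog w ((30 * sigma + 30) * (size L' - k) + 1) c (state 60 L' (size L') 0).
Proof.
elim: d L k c => [|d IH] L k c dk; rewrite leq_eqVlt => /predU1P[Ek|kL] st.
- exists L; rewrite -?Ek //; case: st => r [m [q [p [-> er [r4 r5] IL IM]]]].
  rewrite addn1; apply: reaches_step; rewrite /step /= r4 r5 -Ek eqxx.
  by apply: reaches_now; exists r, m, q, p; rewrite -Ek in r5 *.
- case: st => r [m [q [p [_ _ _ IL _]]]]; have := list_words IL.
  by rewrite /adr; nia.
- exists L; rewrite -?Ek //; case: st => r [m [q [p [-> er [r4 r5] IL IM]]]].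
  rewrite addn1; apply: reaches_step; rewrite /step /= r4 r5 -Ek eqxx.
  by apply: reaches_now; exists r, m, q, p; rewrite -Ek in r5 *.
have [t tle [L1 LL1 st1]] := next_node st kL.
have [||L' kL' [t' tle' st']] := IH L1 k.+1 _ _ _ st1; [lia | lia |].
exists L'; first lia.
exists (t' + t)%N; last by rewrite /run iterD.
have -> : (size L' - k = (size L' - k.+1).+1)%N by lia.
by rewrite mulnS; lia.
Qed.

Lemma trie_run : exists L : seq (seq Sigma), [/\ (0 < size L)%N,
  forall S, S \in L <-> in_trie X H z S, uniq L,
  (forall s u, s :: u \in L -> u \in L) &
  reaches prog w ((30 * sigma + 44) * size L) (input X z) (fun c =>
   [/\ (60 <= pc c)%N, wreg c 0 = adr (index [::] L) & forall s u, u \in L ->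
     wmem c (adr (index u L) + enum_rank s)%N =
       if s :: u \in L then adr (index (s :: u) L) else 0%N])].
Proof.
have [t tle st] := start_run.
have [|L _ [t' tle' st']] := all_nodes (leqnn _) _ st; first by [].
have := st'; case=> r [m [q [p [E [[r0 _ _ _ _] _] _ [uL rL nL sL fL mL] IM]]]].
have L0 : (0 < size L)%N by case: (L) nL.
exists L; split=> // [S|].
  (* All nodes are done, so [list_mem] reduces to [in_trie]. *)
  split=> [/sL//|]; elim: S => // s u IH inS.
  have Lu : u \in L by apply: IH; apply: (in_trie_suffix wX hH) inS.
  by rewrite mL // index_mem Lu.
exists (t' + t)%N.
  (* The 14 pays for the 13 initial instructions and the exit test, as [L] is nonempty. *)
  rewrite -[44%N]/(30 + 14)%N addnA [leqRHS]mulnDl; move: L0 tle tle'.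
  rewrite subn0. lia.
rewrite /run iterD -/(run _ _ _ _) E; split=> //=.
  by rewrite r0 rL /adr muln0.
exact: mem_child IM.
Qed.

End Run.

(** * The trie on a suffix-closed list of strings *)

Section SuffixTrie.
Variables (Sigma : finType) (L : seq (seq Sigma)).
Hypotheses (L_nil : [::] \in L) (L_suffix : forall s (S : seq Sigma), s :: S \in L -> S \in L).

(** Nodes are the strings themselves. Labels are read upwards, so the first letter labels the edge
    to the parent, which is the tail. *)
Definition suffix_parent (u : seq_sub L) : option (seq_sub L * Sigma) :=
  if ssval u is s :: S' then omap (fun v => (v, s)) (insub S') else None.

Lemma suffix_parentE u v s :
  (suffix_parent v == Some (u, s)) = (ssval v == s :: ssval u).
Proof.
rewrite /suffix_parent; case Ev: (ssval v) => [|t S] //.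
have LS : S \in L by apply: (L_suffix (s := t)); rewrite -Ev; apply: ssvalP.
rewrite insubT /= eqseq_cons -[LHS](inj_eq (@Some_inj _)) /= andbC.
by rewrite -[LHS]/(_ && _) -val_eqE.
Qed.

Lemma suffix_parent_root : suffix_parent (SeqSub L_nil) = None.
Proof. by []. Qed.

(** Parent and label give back the string, and only the empty string has no parent. *)
Lemma suffix_parent_inj : injective suffix_parent.
Proof.
move=> u v; case Ev: (suffix_parent v) => [[p s]|] Eu.
  by apply: val_inj; move/eqP: Eu; move/eqP: Ev; rewrite !suffix_parentE /= => /eqP-> /eqP->.
have none x : suffix_parent x = None -> ssval x = [::].
  rewrite /suffix_parent; case Ex: (ssval x) => [|t S] //.
  have LS : S \in L by apply: (L_suffix (s := t)); rewrite -Ex; apply: ssvalP.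
  by rewrite insubT.
by apply: val_inj; rewrite /= !none.
Qed.

Lemma suffix_root_ancestor u : str_up suffix_parent (SeqSub L_nil) u (ssval u).
Proof.
case: u => S LS /=; elim: S LS => [|s S IH] LS.
  by rewrite (bool_irrelevance LS L_nil); constructor.
apply: (str_up_edge (p := SeqSub (L_suffix LS))); last exact: IH.
by apply/eqP; rewrite suffix_parentE.
Qed.

Definition suffix_trie : trie Sigma :=
  @Trie Sigma (seq_sub L) (SeqSub L_nil) suffix_parent suffix_parent_root
    suffix_parent_inj (fun u => ex_intro _ _ (suffix_root_ancestor u)).

Lemma str_suffix_trie (u : node suffix_trie) (S : seq Sigma) :
  str u (Defs.root suffix_trie) S <-> S = ssval u.
Proof.
split=> [|->]; last exact: suffix_root_ancestor.
elim=> // {S}v p s S /eqP; rewrite suffix_parentE => /eqP Ev _ ->.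
by rewrite Ev.
Qed.

End SuffixTrie.

(* The program and the constants depend on the alphabet only.  The hypothesis on
   w says that w >= log2 (n z) + log2 c. *)
Theorem theorem8 (R : realFieldType) (Sigma : finType) :
  exists (P : program) (c C : nat),
    forall (n : nat) (X : n.-tuple {ffun Sigma -> R}),
      (0 < n)%N -> weighted_sequence X ->
      exists2 H : seq Sigma, heavy_string X H &
        forall (z : R) (w : nat),
          1 <= z -> c%:R * (n%:R * z) <= (2 ^ w)%:R ->
          exists (t : nat) (T : trie Sigma),
            [/\ t%:R <= C%:R * (n%:R * z),
                halted P (run P w t (input X z)),
                solid_factor_trie X z H T
              & stores_trie w (run P w t (input X z)) T].
Proof.
pose sigma := #|Sigma|.
(* There are at most [2 n z] nodes, each of [sigma + 2] words and charged [30 sigma + 44]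
   instructions; [c] leaves room for one more block and the table. *)
exists (trie_program sigma), (4 * sigma + 8)%N, (60 * sigma + 88)%N.
move=> n X n_gt0 wX.
(* The probabilities at the first position sum to 1, so the alphabet is nonempty; [s0] then serves
   as a default value. *)
have [s0 _] : exists s0 : Sigma, True.
  have [|_ sum1] := wX 0%N; first by rewrite size_tuple.
  case: (pickP (@predT Sigma)) => [s _|no]; first by exists s.
  by move/eqP: sum1; rewrite big_pred0 // eq_sym oner_eq0.
have sigma_gt0 : (0 < sigma)%N by apply/card_gt0P; exists s0.
pose weight (x : {ffun Sigma -> R}) k := x (nth s0 (enum Sigma) k).
pose H := [seq nth s0 (enum Sigma) (argmax (weight x) sigma) | x <- X].
have nthH s i : (i < size X)%N ->
    nth s H i = nth s0 (enum Sigma) (argmax (weight X`_i) sigma).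
  by move=> iX; rewrite (nth_map 0).
have hH : heavy_string X H.
  split; first by rewrite size_map.
  move=> i s iX; rewrite nthH //.
  rewrite -[X in _ X <= _](nth_enum_rank s0).
  exact: (@argmaxP _ (weight X`_i)) (ltn_ord (enum_rank s)).
exists H => // z w z1 wz.
have z0 : 0 < z by apply: lt_le_trans z1.
have argmaxH i s : (i < size X)%N ->
    enum_rank (nth s H i) = argmax (fun k => X`_i (nth s (enum Sigma) k)) sigma :> nat.
  move=> iX; rewrite nthH // (@eq_argmax _ _ (weight X`_i)) => [|j jS]; last first.
    by rewrite /weight (set_nth_default s0) // -cardE.
  have := argmax_lt (weight X`_i) sigma_gt0; set a := argmax _ _ => aS.
  rewrite -[a]/(val (Ordinal aS)) -[in RHS](enum_valK (Ordinal aS)) (enum_val_nth s0) /=.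
  by [].
have nz1 : 1 <= n%:R * z.
  by rewrite -[leLHS]mulr1 ler_pM // ler1n.
(* [n + 1 <= 2 n] since [n] is positive. *)
have sizeL (L : seq (seq Sigma)) : uniq L ->
    (forall S : seq Sigma, S \in L -> in_trie X H z S) ->
    (size L)%:R <= 2 * (n%:R * z).
  move=> uL LE; apply: le_trans (size_trie_le wX hH z1 uL LE) _.
  rewrite size_tuple mulrA ler_pM2r // -natrM ler_nat; lia.
have words (L : seq (seq Sigma)) : uniq L ->
    (forall S : seq Sigma, S \in L -> in_trie X H z S) ->
    (adr sigma (size L).+1 + size X * sigma < 2 ^ w)%N.
  move=> uL /(sizeL _ uL) Lnz; rewrite size_tuple -(ltr_nat R).
  apply: lt_le_trans wz; rewrite /adr !(natrD, natrM) -!natr1.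
  have n1 : n%:R <= n%:R * z by rewrite -[leLHS]mulr1 ler_pM2l // ltr0n.
  have s1 : (0 : R) <= sigma%:R by apply: ler0n.
  set x := n%:R * z in nz1 Lnz n1 *; set l := (size L)%:R in Lnz *.
  have : (sigma%:R + 2) * l <= (sigma%:R + 2) * (2 * x) by rewrite ler_wpM2l //; lra.
  have : n%:R * sigma%:R <= x * sigma%:R by rewrite ler_wpM2r.
  have : sigma%:R * 1 <= sigma%:R * x by rewrite ler_wpM2l.
  by nra.
have [L [L0 LE uL fL [t tle [hpc hr hm]]]] :=
  trie_run (erefl _) sigma_gt0 wX hH z1 argmaxH words.
have LE' : forall S, S \in L -> in_trie X H z S by move=> S /LE.
have nL : [::] \in L.
  by apply/LE; rewrite /in_trie /= invf_le1.
exists t, (suffix_trie nL fL); split=> //.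
- have : t%:R <= ((30 * sigma + 44) * size L)%:R :> R by rewrite ler_nat.
  move/le_trans; apply; rewrite natrM.
  have -> : (60 * sigma + 88 = (30 * sigma + 44) * 2)%N by lia.
  by rewrite natrM -mulrA ler_wpM2l // sizeL.
- move=> S; rewrite -in_trieP //; split=> [[u /str_suffix_trie->]|].
    by apply/LE; apply: ssvalP.
  by move/LE => LS; exists (SeqSub LS); apply/str_suffix_trie.
pose addr (u : seq_sub L) := adr sigma (index (ssval u) L).
have idx (u : seq_sub L) : (index (ssval u) L < size L)%N by rewrite index_mem; apply: ssvalP.
exists addr; split.
- move=> u v /eqP; rewrite /addr /adr eqn_add2l eqn_pmul2l // => /eqP uv.
  apply: val_inj; rewrite /= -(nth_index [::] (ssvalP u)) uv nth_index //; exact: ssvalP.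
- move=> u; split=> //; have := words L uL LE'; have := idx u.
  rewrite /addr /adr; nia.
- by [].
move=> u s; rewrite hm; last exact: ssvalP.
(* The only candidate for [v] is the node [s :: u]. *)
case: pickP => [v pv|no].
  have /eqP <- : ssval v == s :: ssval u by rewrite -(suffix_parentE fL).
  by rewrite ifT //; apply: ssvalP.
case: ifP => // Lsu; have := no (SeqSub Lsu).
by rewrite [X in X = _](suffix_parentE fL) eqxx.
Qed.
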